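(* If there exists a torsion-free abelian countably compact Hausdorff topological group without non-trivial convergent sequences, then there exists a Tychonoff countably compact topological semigroup containing a subsemigroup isomorphic to the bicyclic semigroup $\mathcal C(p,q)$.
   Context: The bicyclic semigroup $\mathcal C(p,q)$ is the semigroup with identity generated by $p,q$ subject to the single relation $qp=1$. A non-trivial convergent sequence is a convergent sequence that is not eventually constant. *)

(* Defs.v *)
From Stdlib Require Import Reals List.
Import ListNotations.
Open Scope R_scope.

Definition is_topology {X : Type} (op : (X -> Prop) -> Prop) : Prop :=
  op (fun _ => True) /\
  (forall U V, op U -> op V -> op (fun x => U x /\ V x)) /\
  (forall F : (X -> Prop) -> Prop, (forall U, F U -> op U) ->
     op (fun x => exists U, F U /\ U x)).

Definition closed_set {X : Type} (op : (X -> Prop) -> Prop) (F : X -> Prop) : Prop :=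
  op (fun x => ~ F x).

Definition hausdorff {X : Type} (op : (X -> Prop) -> Prop) : Prop :=
  forall x y : X, x <> y -> exists U V, op U /\ op V /\ U x /\ V y /\
    (forall z, U z -> V z -> False).

Definition T1 {X : Type} (op : (X -> Prop) -> Prop) : Prop :=
  forall x y : X, x <> y -> exists U, op U /\ U x /\ ~ U y.

Definition continuous_real {X : Type} (op : (X -> Prop) -> Prop) (f : X -> R) : Prop :=
  forall x (eps : R), 0 < eps -> exists U, op U /\ U x /\
    forall y, U y -> Rabs (f y - f x) < eps.

Definition tychonoff {X : Type} (op : (X -> Prop) -> Prop) : Prop :=
  T1 op /\
  forall (F : X -> Prop) (x : X), closed_set op F -> ~ F x ->
    exists f : X -> R, continuous_real op f /\
      (forall y, 0 <= f y <= 1) /\ f x = 0 /\ (forall y, F y -> f y = 1).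

Definition countably_compact {X : Type} (op : (X -> Prop) -> Prop) : Prop :=
  forall U : nat -> X -> Prop, (forall n, op (U n)) ->
    (forall x, exists n, U n x) ->
    exists N : nat, forall x, exists n, (n <= N)%nat /\ U n x.

Definition converges_to {X : Type} (op : (X -> Prop) -> Prop) (s : nat -> X) (x : X) : Prop :=
  forall U, op U -> U x -> exists N, forall n, (N <= n)%nat -> U (s n).

Definition eventually_constant {X : Type} (s : nat -> X) : Prop :=
  exists N, forall n, (N <= n)%nat -> s n = s N.

Definition no_nontrivial_convergent_sequences {X : Type} (op : (X -> Prop) -> Prop) : Prop :=
  forall (s : nat -> X) (x : X), converges_to op s x -> eventually_constant s.

Definition abelian_group {G : Type} (mul : G -> G -> G) (inv : G -> G) (e : G) : Prop :=
  (forall x y z, mul x (mul y z) = mul (mul x y) z) /\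
  (forall x, mul e x = x) /\
  (forall x, mul (inv x) x = e) /\
  (forall x y, mul x y = mul y x).

Fixpoint gpow {G : Type} (mul : G -> G -> G) (e : G) (x : G) (n : nat) : G :=
  match n with O => e | S k => mul x (gpow mul e x k) end.

Definition torsion_free {G : Type} (mul : G -> G -> G) (e : G) : Prop :=
  forall (x : G) (n : nat), (1 <= n)%nat -> gpow mul e x n = e -> x = e.

Definition continuous_mul {X : Type} (op : (X -> Prop) -> Prop) (mul : X -> X -> X) : Prop :=
  forall x y W, op W -> W (mul x y) ->
    exists U V, op U /\ op V /\ U x /\ V y /\ forall a b, U a -> V b -> W (mul a b).

Definition continuous_inv {X : Type} (op : (X -> Prop) -> Prop) (inv : X -> X) : Prop :=
  forall x W, op W -> W (inv x) -> exists U, op U /\ U x /\ forall a, U a -> W (inv a).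

Definition semigroup {S : Type} (mul : S -> S -> S) : Prop :=
  forall x y z, mul x (mul y z) = mul (mul x y) z.

(** * The bicyclic semigroup C(p,q) = < p, q | qp = 1 > (a monoid presentation):
    words over {p,q} modulo the congruence generated by  q p = (empty word). *)
Inductive pq_letter := Lp | Lq.

Inductive bicyclic_cong : list pq_letter -> list pq_letter -> Prop :=
| bc_step : forall u v, bicyclic_cong (u ++ [Lq; Lp] ++ v) (u ++ v)
| bc_refl : forall w, bicyclic_cong w w
| bc_sym : forall w v, bicyclic_cong w v -> bicyclic_cong v w
| bc_trans : forall w v t, bicyclic_cong w v -> bicyclic_cong v t -> bicyclic_cong w t.

(** S contains a subsemigroup isomorphic to C(p,q): there is an injective semigroup
    homomorphism from C(p,q) to S, given on representing words (its image is the subsemigroup). *)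
Definition contains_bicyclic {S : Type} (mul : S -> S -> S) : Prop :=
  exists h : list pq_letter -> S,
    (forall w v, h (w ++ v) = mul (h w) (h v)) /\
    (forall w v, h w = h v <-> bicyclic_cong w v).

(* Main.v *)
(** In the additive group [G] fix [g <> 0], an element of infinite order. The heart of
    the matter is a subsemigroup [Y] of [G], invariant under translation by [g] and [-g] and
    disjoint from the multiples of [g], such that every sequence in [Y] together with the multiples
    of [g] that takes each value finitely often has a cluster point in [Y].

    As there are no non-trivial convergent sequences, two cluster points can always be separated,
    and a Cantor tree shows that each such sequence has continuum many cluster points.
    Transfinite recursion along a well-order of the Cantor set with small initial segments then
    picks, for every sequence of formal expressions in the points chosen earlier, a cluster point
    [y] with [n y + h <> 0] for all [n >= 1] and all [h] in the semigroup generated by the earlier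
    points and the multiples of [g]; since [G] is torsion-free, each [h] excludes only one [y] for
    each [n]. [Y] consists of the sums that involve at least one chosen point.

    The semigroup is the disjoint union of the bicyclic semigroup, of the integers, to which
    [p^a q^b] with [a - b = z] converges as [a] grows, and of [Y], whose points have as basic
    neighbourhoods the preimages of open sets under the homomorphism to [G] extending
    [p^a q^b |-> (a - b) g]. The product of two points of [Y] is again in [Y], hence never the
    limit of the constant values of [q^n p^n = 1]. *)

Require Import Defs.
From Stdlib Require Import Reals List Lia Lra Cantor.
From Stdlib Require Import Classical ClassicalEpsilon FunctionalExtensionality.
From mathcomp Require boolp wochoice.
Import ListNotations.
Set Bullet Behavior "Strict Subproofs".
Open Scope nat_scope.

(** * Cardinality *)

Definition strict_total {K : Type} (lt : K -> K -> Prop) : Prop :=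
  well_founded lt /\
  (forall x y z, lt x y -> lt y z -> lt x z) /\
  (forall x y, lt x y \/ x = y \/ lt y x).

(** The least element of a pair is unique, which makes the non-strict order [R] antisymmetric; least
    elements of pairs and triples then give totality and transitivity of its strict part. *)
Lemma well_ordering (K : Type) : exists lt : K -> K -> Prop, strict_total lt.
Proof.
  destruct (wochoice.well_ordering_principle (boolp.boolp_classicType__canonical__eqtype_Equality K)) as [R wo].
  assert (least : forall P : K -> Prop, (exists x, P x) ->
            exists m, P m /\ forall x, P x -> R m x = true).
  { intros P [x Px].
    destruct (wo (fun x => boolp.asbool (P x))) as [m [[Pm min] _]].
    - exists x. apply boolp.asboolT. exact Px.
    - exists m. split.
      + apply (boolp.asboolW Pm).
      + intros y Py. apply min. apply boolp.asboolT. exact Py. }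
  assert (refl : forall x, R x x = true).
  { intro x. destruct (least (fun y => y = x) (ex_intro _ x eq_refl)) as [m [-> H]]. auto. }
  assert (anti : forall x y, R x y = true -> R y x = true -> x = y).
  { intros x y Hxy Hyx.
    destruct (wo (fun z => boolp.asbool (z = x \/ z = y))) as [m [_ uni]].
    - exists x. apply boolp.asboolT. auto.
    - transitivity m; [symmetry|]; apply uni; split;
        try (apply boolp.asboolT; auto); intros z Hz; apply boolp.asboolW in Hz;
        destruct Hz as [-> | ->]; auto; apply refl. }
  exists (fun x y => x <> y /\ R x y = true). split; [|split].
  - intro a. apply NNPP. intro Ha.
    destruct (least (fun x => ~ Acc (fun x y => x <> y /\ R x y = true) x)
                (ex_intro _ a Ha)) as [m [Hm min]].
    apply Hm. constructor. intros y [ne Hy]. apply NNPP. intro Ny.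
    apply ne, anti; auto.
  - intros x y z [H H1] [H0 H2].
    assert (E : x <> z) by (intros ->; apply H, anti; auto). split; [exact E|].
    destruct (least (fun t => t = x \/ t = y \/ t = z)) as [m [Hm min]]; [eauto|].
    destruct Hm as [-> | [-> | ->]].
    + apply min; auto.
    + elim H. apply anti; auto.
    + elim H0. apply anti; auto.
  - intros x y. destruct (classic (x = y)) as [|ne]; [auto|].
    destruct (least (fun t => t = x \/ t = y)) as [m [[-> | ->] min]]; [eauto| |].
    + left. auto.
    + right; right. split; auto.
Qed.

Lemma wf_least {K : Type} (lt : K -> K -> Prop) (P : K -> Prop) :
  well_founded lt -> (exists x, P x) -> exists m, P m /\ forall x, lt x m -> ~ P x.
Proof.
  intros wf [x Px]. apply NNPP. intro H. revert x Px.
  apply (well_founded_ind wf (fun x => ~ P x)). intros x IH Px.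
  apply H. exists x. auto.
Qed.

Definition word (K : Type) : Type := list (K + nat).

Definition over {K : Type} (P : K -> Prop) (l : word K) : Prop :=
  forall a, In (inl a) l -> P a.

(* For an infinite [P] the words over [P] are as many as the elements of [P], so on
   uncountable [K] this says that [P] has smaller cardinality than [K]; counting words
   instead of letters makes closure under word formation provable without
   cardinal arithmetic. *)
Definition small {K : Type} (P : K -> Prop) : Prop :=
  forall f : word K -> K, exists k, forall l, over P l -> f l <> k.

(* A word over the image of [f] is coded by a word over the source: a block [u] closed by
   [inr 0] codes the letter [inl (f u)], and any [n] letters closed by [inr 1] code [inr n];
   [shift] keeps the two closing marks out of the blocks. *)
Fixpoint decode {K : Type} (f : word K -> K) (acc l : word K) : word K :=
  match l with
  | [] => []
  | inl a :: t => decode f (acc ++ [inl a]) t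
  | inr 0 :: t => inl (f acc) :: decode f [] t
  | inr 1 :: t => inr (length acc) :: decode f [] t
  | inr (S (S n)) :: t => decode f (acc ++ [inr n]) t
  end.

Definition shift {K : Type} (x : K + nat) : K + nat :=
  match x with inl a => inl a | inr n => inr (S (S n)) end.

Lemma decode_shift {K : Type} (f : word K -> K) (u acc t : word K) :
  decode f acc (map shift u ++ t) = decode f (acc ++ u) t.
Proof.
  revert acc. induction u as [|[a|n] u IH]; intro acc; simpl.
  - now rewrite app_nil_r.
  - now rewrite IH, <- app_assoc.
  - now rewrite IH, <- app_assoc.
Qed.

Lemma in_shift {K : Type} (u : word K) (a : K) : In (inl a) (map shift u) -> In (inl a) u.
Proof.
  intro H. apply in_map_iff in H. destruct H as [[b|n] [E H]]; simpl in E; congruence.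
Qed.

(** Every word over [Q] is decoded from a word over [P]. A value missed by [h] composed with
    [decode f] on words over [P] is therefore missed by [h] on words over [Q]. *)
Lemma small_image {K : Type} (P Q : K -> Prop) (f : word K -> K) :
  small P -> (forall q, Q q -> exists l, over P l /\ f l = q) -> small Q.
Proof.
  intros HP Hf h. destruct (HP (fun l => h (decode f [] l))) as [k Hk].
  exists k. intros v Hv.
  assert (E : exists l, over P l /\ decode f [] l = v).
  { clear Hk. induction v as [|[a|n] v IH].
    - exists []. split; [intros a []|reflexivity].
    - destruct IH as [l [Hl El]]; [intros b Hb; apply Hv; now right|].
      destruct (Hf a) as [u [Hu Eu]]; [apply Hv; now left|].
      exists (map shift u ++ inr 0 :: l). split.
      + intros b Hb. apply in_app_or in Hb. destruct Hb as [Hb|[Hb|Hb]].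
        * apply Hu, in_shift, Hb.
        * discriminate.
        * auto.
      + rewrite decode_shift. simpl. now rewrite Eu, El.
    - destruct IH as [l [Hl El]]; [intros b Hb; apply Hv; now right|].
      exists (map shift (repeat (inr 0) n) ++ inr 1 :: l). split.
      + intros b Hb. apply in_app_or in Hb. destruct Hb as [Hb|[Hb|Hb]].
        * apply in_shift, repeat_spec in Hb. discriminate.
        * discriminate.
        * auto.
      + rewrite decode_shift. simpl. now rewrite repeat_length, El. }
  destruct E as [l [Hl <-]]. auto.
Qed.

Lemma small_succ {K : Type} (P : K -> Prop) (a : K) :
  small P -> small (fun x => P x \/ x = a).
Proof.
  intro HP. apply (small_image P _ (fun l => match l with [inl k] => k | _ => a end) HP).
  intros q [Hq| ->].
  - exists [inl q]. split; [|reflexivity]. intros b [Hb|[]]. congruence.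
  - exists []. split; [intros b []|reflexivity].
Qed.

Lemma small_subset {K : Type} (P Q : K -> Prop) :
  small P -> (forall x, Q x -> P x) -> small Q.
Proof.
  intros HP HPQ f. destruct (HP f) as [k Hk]. exists k. intros l Hl.
  apply Hk. intros a Ha. auto.
Qed.

(** The bound is the maximum of [b] and the finitely many letters. *)
Lemma over_bounded {K : Type} (lt : K -> K -> Prop) (a b : K) (l : word K) :
  strict_total lt -> lt b a -> over (fun x => lt x a) l ->
  exists m, lt m a /\ over (fun x => lt x m \/ x = m) l.
Proof.
  intros [_ [tr tri]] Hb. induction l as [|[c|n] l IH]; intro Hl.
  - exists b. split; [exact Hb|]. intros x [].
  - destruct IH as [m [Hm Om]]; [intros x Hx; apply Hl; now right|].
    assert (Hc : lt c a) by (apply Hl; now left).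
    destruct (tri m c) as [H|[<-|H]].
    + exists c. split; [exact Hc|]. intros x [E|Hx]; [right; congruence|].
      destruct (Om x Hx) as [H1| ->]; eauto.
    + exists m. split; [exact Hc|]. intros x [E|Hx]; [right; congruence|auto].
    + exists m. split; [exact Hm|]. intros x [E|Hx]; [left; congruence|auto].
  - destruct IH as [m [Hm Om]]; [intros x Hx; apply Hl; now right|].
    exists m. split; [exact Hm|]. intros x [E|Hx]; [discriminate|auto].
Qed.

(* If some proper initial segment is not small, let {<a} be the least one: words over it
   enumerate [K], and we reorder [K] by the least [b < a] such that a word over {<= b} is
   needed. *)
Lemma small_segments_order (K : Type) :
  small (fun _ : K => False) ->
  exists lt : K -> K -> Prop, strict_total lt /\ forall a, small (fun x => ~ lt a x).
Proof.
  intro small0. destruct (well_ordering K) as [lt [wf [tr tri]]].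
  destruct (classic (forall a, small (fun x => lt x a))) as [sm|nsm].
  { exists lt. split; [split; [|split]; assumption|]. intro a.
    apply (small_subset _ _ (small_succ _ a (sm a))). intros x Hx.
    destruct (tri x a) as [H|[H|H]]; tauto. }
  apply not_all_ex_not in nsm.
  destruct (wf_least lt _ wf nsm) as [a [Ha sm]].
  assert (small_le : forall b, lt b a -> small (fun x => lt x b \/ x = b)).
  { intros b Hb. apply small_succ. apply NNPP, sm, Hb. }
  apply not_all_ex_not in Ha. destruct Ha as [f Hf].
  (* If nothing lay below [a], words over [{<a}] would have no [inl] letters, and [small0] would
     give a value missed by [f]. *)
  assert (Hb : exists b, lt b a).
  { apply NNPP. intro N. destruct (small0 f) as [k Hk]. apply Hf. exists k.
    intros l Hl. apply Hk. intros b Hb. apply N. exists b. apply Hl, Hb. }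
  destruct Hb as [b0 Hb0].
  assert (rk : forall x, exists b, (lt b a /\ exists l, over (fun y => lt y b \/ y = b) l /\ f l = x)
     /\ forall c, lt c b -> ~ (lt c a /\ exists l, over (fun y => lt y c \/ y = c) l /\ f l = x)).
  { intro x. apply (wf_least lt _ wf).
    assert (E : exists l, over (fun x => lt x a) l /\ f l = x).
    { apply NNPP. intro N. apply Hf. exists x. intros l Hl E. apply N. eauto. }
    destruct E as [l [Hl E]].
    destruct (over_bounded lt a b0 l (conj wf (conj tr tri)) Hb0 Hl) as [m [Hm Om]]. eauto. }
  destruct (choice _ rk) as [rho Hrho].
  exists (fun x y => lt (rho x) (rho y) \/ (rho x = rho y /\ lt x y)). split.
  - split; [|split].
    + assert (H : forall r x, rho x = r ->
        Acc (fun x y => lt (rho x) (rho y) \/ (rho x = rho y /\ lt x y)) x).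
      { intro r. induction (wf r) as [r _ IHr]. intro x.
        induction (wf x) as [x _ IHx]. intro Ex. constructor.
        intros y [Hy|[Ey Hy]].
        - apply (IHr (rho y)); congruence.
        - apply IHx; congruence. }
      intro x. apply (H (rho x) x eq_refl).
    + intros x y z [H|[E H]] [H'|[E' H']].
      * left; eauto.
      * left; congruence.
      * left; congruence.
      * right; split; [congruence|eauto].
    + intros x y. destruct (tri (rho x) (rho y)) as [H|[H|H]]; auto.
      destruct (tri x y) as [H'|[H'|H']]; auto.
  (* What is not above [c] has rank at most [rho c], hence is the image under [f] of a word over the
     small set [{<= rho c}]. *)
  - intro c. destruct (Hrho c) as [[Hc _] _].
    apply (small_image _ _ f (small_le _ Hc)). intros x Hx.
    destruct (Hrho x) as [[_ [l [Hl El]]] _]. exists l. split; [|exact El].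
    intros y Hy. destruct (tri (rho x) (rho c)) as [H|[H|H]].
    + left. destruct (Hl y Hy) as [H1| ->]; eauto.
    + rewrite <- H. auto.
    + tauto.
Qed.

(** * Surjections from the Cantor set and the enumeration of sequences of words *)

Definition onto {A B : Type} (f : A -> B) : Prop := forall b, exists a, f a = b.

Notation cantor := (nat -> bool).

Lemma cantor_onto_seq : exists f : cantor -> nat -> cantor, onto f.
Proof.
  exists (fun k n m => k (to_nat (n, m))). intro s.
  exists (fun i => s (fst (of_nat i)) (snd (of_nat i))).
  extensionality n. extensionality m. now rewrite cancel_of_to.
Qed.

Lemma cantor_onto_nat : exists f : cantor -> nat, onto f.
Proof.
  exists (fun k => epsilon (inhabits 0) (fun n => k = Nat.eqb n)).
  intro n. exists (Nat.eqb n).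
  set (m := epsilon _ _).
  assert (E : Nat.eqb n = Nat.eqb m) by (apply epsilon_spec; eauto).
  apply Nat.eqb_eq. rewrite <- E. apply Nat.eqb_refl.
Qed.

Lemma cantor_onto_prod {A B : Type} (f : cantor -> A) (g : cantor -> B) :
  onto f -> onto g -> exists h : cantor -> A * B, onto h.
Proof.
  intros Hf Hg. destruct cantor_onto_seq as [s Hs].
  exists (fun k => (f (s k 0), g (s k 1))). intros [a b].
  destruct (Hf a) as [x <-], (Hg b) as [y <-].
  destruct (Hs (fun n => match n with 0 => x | _ => y end)) as [k Hk].
  exists k. now rewrite Hk.
Qed.

Lemma cantor_onto_sequences {A : Type} (f : cantor -> A) :
  onto f -> exists h : cantor -> nat -> A, onto h.
Proof.
  intro Hf. destruct cantor_onto_seq as [s Hs].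
  exists (fun k n => f (s k n)). intro a.
  destruct (choice _ (fun n => Hf (a n))) as [b Hb]. destruct (Hs b) as [k Hk].
  exists k. extensionality n. rewrite Hk. apply Hb.
Qed.

Lemma cantor_onto_list {A : Type} (f : cantor -> A) :
  onto f -> exists h : cantor -> list A, onto h.
Proof.
  intro Hf. destruct (cantor_onto_sequences f Hf) as [s Hs].
  destruct cantor_onto_nat as [p Hp]. destruct (cantor_onto_prod p s Hp Hs) as [h Hh].
  exists (fun k => map (snd (h k)) (seq 0 (fst (h k)))). intro l.
  (* The point [f c] is a default for [nth]. *)
  destruct (Hf (f (fun _ => true))) as [c _].
  destruct (Hh (length l, fun i => nth i l (f c))) as [k Hk]. exists k. rewrite Hk. simpl.
  apply (nth_ext _ _ (f c) (f c)).
  - now rewrite length_map, length_seq.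
  - intros n Hn. rewrite length_map, length_seq in Hn.
    rewrite (nth_indep _ _ (nth 0 l (f c))) by now rewrite length_map, length_seq.
    rewrite (map_nth (fun i => nth i l (f c)) _ 0). now rewrite seq_nth.
Qed.

Lemma cantor_onto_letter : exists f : cantor -> cantor + nat, onto f.
Proof.
  destruct cantor_onto_nat as [p Hp].
  assert (Hid : onto (fun k : cantor => k)) by (intro k; eauto).
  destruct (cantor_onto_prod p _ Hp Hid) as [h Hh].
  exists (fun k => match fst (h k) with 0 => inl (snd (h k)) | S n => inr n end).
  intros [a|n].
  - destruct (Hh (0, a)) as [k Hk]. exists k. now rewrite Hk.
  - destruct (Hh (S n, fun _ => true)) as [k Hk]. exists k. now rewrite Hk.
Qed.

Fixpoint code (l : list nat) : nat :=
  match l with [] => 0 | a :: t => S (to_nat (a, code t)) end.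

Lemma code_inj (l l' : list nat) : code l = code l' -> l = l'.
Proof.
  revert l'. induction l as [|a l IH]; intros [|b l'] E; try discriminate; auto.
  apply eq_add_S, (f_equal of_nat) in E. rewrite !cancel_of_to in E.
  injection E as -> E. f_equal. auto.
Qed.

(** Cantor's diagonal argument: words without letters from [cantor] are lists of naturals, and the
    chosen sequence differs from the value of [f] at the list [l'] in position [code l']. *)
Lemma small_empty : small (fun _ : cantor => False).
Proof.
  intro f.
  set (d := fun n => epsilon (inhabits []) (fun l => code l = n)).
  exists (fun n => negb (f (map inr (d n)) n)). intros l Hl E.
  assert (El : exists l', l = map inr l').
  { clear E. induction l as [|[a|n] l IH].
    - exists []; reflexivity.
    - destruct (Hl a). now left.
    - destruct IH as [l' ->]; [intros a Ha; apply (Hl a); now right|]. now exists (n :: l'). }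
  destruct El as [l' ->].
  assert (D : d (code l') = l').
  { apply code_inj. unfold d. apply epsilon_spec. eauto. }
  apply (f_equal (fun k => k (code l'))) in E. rewrite D in E.
  destruct (f (map inr l') (code l')); discriminate.
Qed.

(* König's diagonal argument: countably many small initial segments do not exhaust the
   fibre of [snd psi] over [w]. *)
Lemma bookkeeping (lt : cantor -> cantor -> Prop) :
  strict_total lt -> (forall a, small (fun x => ~ lt a x)) ->
  exists phi : cantor -> nat -> word cantor,
    forall w, exists b, phi b = w /\ forall n, over (fun x => lt x b) (w n).
Proof.
  intros [_ [tr tri]] sm.
  destruct cantor_onto_letter as [f1 H1]. destruct (cantor_onto_list f1 H1) as [f2 H2].
  destruct (cantor_onto_sequences f2 H2) as [f3 H3]. destruct cantor_onto_seq as [f4 H4].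
  destruct (cantor_onto_prod f4 f3 H4 H3) as [psi Hpsi].
  exists (fun k => snd (psi k)). intro w. apply NNPP. intro N.
  (* The number [n] codes position [j] of the word [w i]. If the letter there is [a], the [b] not
     above [a] form a small set, so the [n]-th coordinates belonging to them omit some [z]. *)
  assert (Z : forall n, exists z, forall i j a, n = to_nat (i, j) ->
            nth_error (w i) j = Some (inl a) ->
            forall b, ~ lt a b -> fst (psi b) n <> z).
  { intro n. destruct (of_nat n) as [i j] eqn:En.
    destruct (nth_error (w i) j) as [[a|m]|] eqn:E.
    - destruct (sm a (fun l => match l with [inl b] => fst (psi b) n | _ => fun _ => true end))
        as [z Hz].
      exists z. intros i' j' a' -> Ea b Hb. rewrite cancel_of_to in En. injection En as -> ->.
      apply (Hz [inl b]). intros x [Hx|[]]. congruence.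
    - exists (fun _ => true). intros i' j' a' -> Ea. rewrite cancel_of_to in En. congruence.
    - exists (fun _ => true). intros i' j' a' -> Ea. rewrite cancel_of_to in En. congruence. }
  destruct (choice _ Z) as [z Hz]. destruct (Hpsi (z, w)) as [b Hb].
  apply N. exists b. rewrite Hb. split; [reflexivity|]. intros i a Ha. apply NNPP. intro Hab.
  destruct (In_nth_error _ _ Ha) as [j Hj].
  apply (Hz (to_nat (i, j)) i j a eq_refl Hj b Hab). now rewrite Hb.
Qed.

(** * Cluster points and topological groups *)

Definition infinite_set (A : nat -> Prop) : Prop :=
  forall N, exists n, N <= n /\ A n.

(** Clustering is taken along the indices in [A], so that the Cantor tree can consist of index sets
    for one fixed sequence. *)
Definition cluster {X : Type} (op : (X -> Prop) -> Prop) (s : nat -> X)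
    (A : nat -> Prop) (x : X) : Prop :=
  forall U, op U -> U x -> infinite_set (fun n => A n /\ U (s n)).

Definition finite_to_one {X : Type} (s : nat -> X) : Prop :=
  forall v, exists N, forall n, N <= n -> s n <> v.

Lemma infinite_set_sequence (A : nat -> nat -> Prop) :
  (forall n, infinite_set (A n)) -> exists m : nat -> nat, forall n, n <= m n /\ A n (m n).
Proof. intro H. apply (choice (fun n i => n <= i /\ A n i)). intro n. apply H. Qed.

Section CountablyCompact.

Context {X : Type} (op : (X -> Prop) -> Prop).
Hypothesis top : is_topology op.
Hypothesis cc : countably_compact op.

(** Without a cluster point, the open sets that miss all terms with index in [A] from [N] on cover
    the space as [N] varies; a finite subcover is refuted by a term of large index in [A]. *)
Lemma cluster_exists (s : nat -> X) (A : nat -> Prop) :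
  infinite_set A -> exists x, cluster op s A x.
Proof.
  intro HA. apply NNPP. intro H.
  set (miss := fun N U => op U /\ forall n, N <= n -> A n -> ~ U (s n)).
  destruct (cc (fun N x => exists U, miss N U /\ U x)) as [N HN].
  - intro N. apply top. intros U [HU _]. exact HU.
  - intro x. apply NNPP. intro Hx. apply H. exists x. intros U oU Ux N. apply NNPP. intro K.
    apply Hx. exists N, U. split; [|exact Ux]. split; [exact oU|].
    intros n Hn An Un. apply K. eauto.
  - destruct (HA N) as [n [Hn An]]. destruct (HN (s n)) as [i [Hi [U [[_ HU] Us]]]].
    apply (HU n); [lia|exact An|exact Us].
Qed.

Hypothesis nc : no_nontrivial_convergent_sequences op.
Hypothesis sep : forall x y : X, x <> y ->
  exists f : X -> R, continuous_real op f /\ f x = 0%R /\ f y = 1%R.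

Lemma cluster_le (f : X -> R) (s : nat -> X) (A : nat -> Prop) (r : R) (x : X) :
  continuous_real op f -> cluster op s A x -> (forall n, A n -> f (s n) < r)%R -> (f x <= r)%R.
Proof.
  intros Cf Cx H. destruct (Rle_lt_dec (f x) r) as [|L]; [assumption|].
  destruct (Cf x (f x - r)%R) as [U [oU [Ux HU]]]; [lra|].
  destruct (Cx U oU Ux 0) as [n [_ [An Un]]].
  specialize (HU _ Un). specialize (H _ An). apply Rabs_def2 in HU. lra.
Qed.

Lemma cluster_ge (f : X -> R) (s : nat -> X) (A : nat -> Prop) (r : R) (x : X) :
  continuous_real op f -> cluster op s A x -> (forall n, A n -> r < f (s n))%R -> (r <= f x)%R.
Proof.
  intros Cf Cx H. destruct (Rle_lt_dec r (f x)) as [|L]; [assumption|].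
  destruct (Cf x (r - f x)%R) as [U [oU [Ux HU]]]; [lra|].
  destruct (Cx U oU Ux 0) as [n [_ [An Un]]].
  specialize (HU _ Un). specialize (H _ An). apply Rabs_def2 in HU. lra.
Qed.

(** If every neighbourhood of a cluster point [x] left out only finitely many terms, a subsequence
    would converge to [x] and be eventually constant, against finite-to-one. So the terms outside
    some neighbourhood cluster at some [y <> x]. The thresholds 1/3 and 2/3 for a function
    separating [x] from [y] leave a gap that keeps the two cluster sets disjoint. *)
Lemma cluster_split (s : nat -> X) (A : nat -> Prop) :
  finite_to_one s -> infinite_set A ->
  exists D : bool -> nat -> Prop,
    (forall b, infinite_set (D b)) /\ (forall b n, D b n -> A n) /\
    (forall x y, cluster op s (D true) x -> cluster op s (D false) y -> x <> y).
Proof.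
  intros fs HA. destruct (cluster_exists s A HA) as [x Cx].
  assert (HU : exists U, op U /\ U x /\ infinite_set (fun n => A n /\ ~ U (s n))).
  { apply NNPP. intro H. destruct (infinite_set_sequence (fun _ => A) (fun _ => HA)) as [m Hm].
    destruct (nc (fun n => s (m n)) x) as [N HN].
    - intros U oU Ux. apply NNPP. intro K. apply H. exists U. split; [exact oU|].
      split; [exact Ux|]. intro N. apply NNPP. intro K'. apply K. exists N. intros n Hn.
      apply NNPP. intro K2. apply K'. exists (m n). destruct (Hm n) as [H1 H2].
      split; [lia|auto].
    - destruct (fs (s (m N))) as [N' HN']. apply (HN' (m (N + N'))).
      + destruct (Hm (N + N')). lia.
      + apply HN. lia. }
  destruct HU as [U [oU [Ux HU]]]. destruct (cluster_exists s _ HU) as [y Cy].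
  assert (xy : x <> y).
  { intros <-. destruct (Cy U oU Ux 0) as [n [_ [[_ H] H']]]. auto. }
  destruct (sep x y xy) as [f [Cf [fx fy]]].
  exists (fun b n => A n /\ if b : bool then (f (s n) < 1/3)%R else (2/3 < f (s n))%R).
  split; [|split].
  - intros [|] N.
    + destruct (Cf x (1/3)%R) as [V [oV [Vx HV]]]; [lra|].
      destruct (Cx V oV Vx N) as [n [Hn [An Vn]]]. exists n. split; [exact Hn|].
      split; [exact An|]. specialize (HV _ Vn). apply Rabs_def2 in HV. lra.
    + destruct (Cf y (1/3)%R) as [V [oV [Vy HV]]]; [lra|].
      destruct (Cy V oV Vy N) as [n [Hn [[An _] Vn]]]. exists n. split; [exact Hn|].
      split; [exact An|]. specialize (HV _ Vn). apply Rabs_def2 in HV. lra.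
  - intros b n [H _]. exact H.
  - intros u v Cu Cv <-.
    assert (H1 := cluster_le f s _ (1/3)%R u Cf Cu (fun n H => proj2 H)).
    assert (H2 := cluster_ge f s _ (2/3)%R u Cf Cv (fun n H => proj2 H)). lra.
Qed.

(** The latest bit comes first, so that a node of the tree is defined from its parent by recursion
    on the list. *)
Fixpoint prefix (x : nat -> bool) (n : nat) : list bool :=
  match n with 0 => [] | S n => x n :: prefix x n end.

Lemma first_difference (x y : nat -> bool) :
  x <> y -> exists n, prefix x n = prefix y n /\ x n <> y n.
Proof.
  intro ne. apply NNPP. intro H. apply ne. extensionality n.
  assert (P : forall n, prefix x n = prefix y n).
  { intro k. induction k as [|k IH]; [reflexivity|]. simpl. rewrite IH. f_equal.
    apply NNPP. intro K. apply H. eauto. }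
  specialize (P (S n)). simpl in P. congruence.
Qed.

Lemma cantor_of_clusters (s : nat -> X) :
  finite_to_one s ->
  exists c : cantor -> X,
    (forall x y, c x = c y -> x = y) /\ forall x, cluster op s (fun _ => True) (c x).
Proof.
  intro fs.
  assert (sp : forall A : nat -> Prop, exists D : bool -> nat -> Prop, infinite_set A ->
    (forall b, infinite_set (D b)) /\ (forall b n, D b n -> A n) /\
    (forall x y, cluster op s (D true) x -> cluster op s (D false) y -> x <> y)).
  { intro A. destruct (classic (infinite_set A)) as [HA|HA].
    - destruct (cluster_split s A fs HA) as [D HD]. exists D. auto.
    - exists (fun _ => A). tauto. }
  destruct (choice _ sp) as [D HD]. clear sp.
  set (T := fix T (l : list bool) : nat -> Prop :=
              match l with [] => fun _ => True | b :: l => D (T l) b end).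
  assert (infT : forall l, infinite_set (T l)).
  { induction l as [|b l IH]; simpl.
    - intro N. exists N. auto.
    - apply (HD _ IH). }
  assert (decT : forall x i n k, T (prefix x (k + n)) i -> T (prefix x n) i).
  { intros x i n k. induction k as [|k IH]; [auto|]. simpl. intro H. apply IH.
    apply (HD _ (infT _)) in H. exact H. }
  (* Take an index [m n] from the [n]-th set of the branch. As the sets decrease, a cluster point of
     this diagonal subsequence is one along every set of the branch. *)
  assert (br : forall x : cantor, exists c, forall n, cluster op s (T (prefix x n)) c).
  { intro x.
    destruct (infinite_set_sequence (fun n => T (prefix x n)) (fun n => infT _)) as [m Hm].
    destruct (cluster_exists (fun n => s (m n)) (fun _ => True)) as [c Hc].
    - intro N. exists N. auto.
    - exists c. intros n U oU Uc N. destruct (Hc U oU Uc (N + n)) as [i [Hi [_ Ui]]].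
      exists (m i). destruct (Hm i) as [H1 H2]. split; [lia|]. split; [|exact Ui].
      apply (decT x _ n (i - n)). now replace (i - n + n) with i by lia. }
  destruct (choice _ br) as [c Hc]. exists c. split.
  - intros x y E. apply NNPP. intro ne. destruct (first_difference x y ne) as [n [P d]].
    assert (Hx := Hc x (S n)). assert (Hy := Hc y (S n)). simpl in Hx, Hy.
    rewrite <- P in Hy. destruct (HD _ (infT (prefix x n))) as [_ [_ H]].
    destruct (x n), (y n); try congruence.
    + exact (H _ _ Hx Hy E).
    + exact (H _ _ Hy Hx (eq_sym E)).
  - intro x. exact (Hc x 0).
Qed.

End CountablyCompact.

(** * Complete regularity of topological groups *)

Section TopologicalGroup.

Context {G : Type} (op : (G -> Prop) -> Prop) (mul : G -> G -> G) (inv : G -> G) (e : G).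
Hypothesis top : is_topology op.
Hypothesis grp : abelian_group mul inv e.
Hypothesis cmul : continuous_mul op mul.
Hypothesis cinv : continuous_inv op inv.

Local Notation "x ⊕ y" := (mul x y) (at level 50, left associativity).

Lemma gassoc x y z : x ⊕ (y ⊕ z) = x ⊕ y ⊕ z.
Proof. apply grp. Qed.

Lemma gcomm x y : x ⊕ y = y ⊕ x.
Proof. apply grp. Qed.

Lemma gid_l x : e ⊕ x = x.
Proof. apply grp. Qed.

Lemma gid_r x : x ⊕ e = x.
Proof. rewrite gcomm. apply gid_l. Qed.

Lemma ginv_l x : inv x ⊕ x = e.
Proof. apply grp. Qed.

Lemma ginv_r x : x ⊕ inv x = e.
Proof. rewrite gcomm. apply ginv_l. Qed.

Lemma gcancel x y z : x ⊕ y = x ⊕ z -> y = z.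
Proof.
  intro E. apply (f_equal (fun t => inv x ⊕ t)) in E.
  now rewrite !gassoc, ginv_l, !gid_l in E.
Qed.

Lemma gadd_swap a b c d : a ⊕ b ⊕ (c ⊕ d) = a ⊕ c ⊕ (b ⊕ d).
Proof.
  rewrite <- (gassoc a b), (gassoc b c), (gcomm b c), <- (gassoc c b). apply gassoc.
Qed.

Definition nbhd (x : G) (V : G -> Prop) : Prop :=
  exists U, op U /\ U x /\ forall y, U y -> V y.

Lemma nbhd_at x V : nbhd x V -> V x.
Proof. intros [U [_ [Ux H]]]. auto. Qed.

Lemma nbhd_translate x y V : nbhd (x ⊕ y) V -> nbhd x (fun z => V (z ⊕ y)).
Proof.
  intros [W [oW [Wx HW]]]. destruct (cmul x y W oW Wx) as [U [U' [oU [_ [Ux [U'y H]]]]]].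
  exists U. auto.
Qed.

Lemma nbhd_half V : nbhd e V ->
  exists V', nbhd e V' /\ (forall x, V' x -> V' (inv x)) /\
    forall x y, V' x -> V' y -> V (x ⊕ y).
Proof.
  intros [W [oW [We HW]]].
  destruct (cmul e e W oW) as [U1 [U2 [o1 [o2 [e1 [e2 H]]]]]]; [now rewrite gid_l|].
  set (V0 := fun x => U1 x /\ U2 x).
  assert (o0 : op V0) by now apply top.
  assert (ie : inv e = e) by (rewrite <- (gid_r (inv e)); apply ginv_l).
  assert (ii : forall x, inv (inv x) = x).
  { intro x. apply (gcancel (inv x)). now rewrite ginv_r, ginv_l. }
  destruct (cinv e V0 o0) as [U3 [o3 [e3 H3]]]; [rewrite ie; now split|].
  exists (fun x => V0 x /\ V0 (inv x)). split; [|split].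
  - exists (fun x => V0 x /\ U3 x). split; [now apply top|]. split; [now repeat split|].
    intros y [Hy Hy']. auto.
  - intros x [Hx Hx']. rewrite ii. auto.
  - intros x y [[Hx _] _] [[_ Hy] _]. auto.
Qed.

Section Urysohn.

Variable U : nat -> G -> Prop.
Hypothesis nbU : forall n, nbhd e (U n).
Hypothesis addU : forall n x y, U (S n) x -> U (S n) y -> U n (x ⊕ y).

(* [level n k] is the sum of the sets [U i] over the binary digits of the dyadic [k / 2^n];
   the Urysohn function is [x |-> sup {k / 2^n : x not in level n k}]. *)
Fixpoint level (n k : nat) (x : G) : Prop :=
  match n with
  | 0 => match k with 0 => x = e | 1 => U 0 x | _ => True end
  | S n => exists j, (k = 2 * j /\ level n j x) \/
      (k = 2 * j + 1 /\ exists a b, level n j a /\ U (S n) b /\ x = a ⊕ b)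
  end.

(** This is binary addition of one unit in the last place: if the last digit is already 1, [addU]
    performs the carry by merging two summands from [U (S n)] into one from [U n]. *)
Lemma level_add n k a b : level n k a -> U n b -> level n (S k) (a ⊕ b).
Proof.
  revert k a b. induction n as [|n IH]; intros k a b.
  - destruct k as [|[|k]]; simpl; auto. intros ->. now rewrite gid_l.
  - intros [j [[-> Hj]|[-> [a' [b' [Ha [Hb' ->]]]]]]] Hb.
    + exists j. right. split; [lia|]. exists a, b. auto.
    + exists (S j). left. split; [lia|]. rewrite <- gassoc. auto.
Qed.

Lemma level_mono n k k' x : k <= k' -> level n k x -> level n k' x.
Proof.
  intro H. induction H as [|k' _ IH]; [auto|]. intro Hx.
  rewrite <- (gid_r x). apply level_add; [auto|]. apply nbhd_at, nbU.
Qed.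

Lemma level_double n k x : level (S n) (2 * k) x <-> level n k x.
Proof.
  split.
  - intros [j [[E H]|[E _]]]; [|lia]. now replace k with j by lia.
  - intro H. exists k. auto.
Qed.

Lemma level_refine n m k x : level (m + n) (2 ^ m * k) x <-> level n k x.
Proof.
  induction m as [|m IH].
  - simpl. now rewrite Nat.add_0_r.
  - rewrite <- IH. rewrite Nat.pow_succ_r', <- Nat.mul_assoc. apply level_double.
Qed.

Lemma level_full n x : level n (2 ^ n * 2) x.
Proof. rewrite <- (Nat.add_0_r n) at 1. now rewrite level_refine. Qed.

Lemma level_compare n k m j x : level n k x -> k * 2 ^ m <= j * 2 ^ n -> level m j x.
Proof.
  intros H L. apply (level_refine m n). rewrite Nat.add_comm.
  apply (level_mono _ (2 ^ m * k)); [lia|]. now apply level_refine.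
Qed.

Open Scope R_scope.

Lemma urysohn_sequence :
  exists f : G -> R, f e = 0 /\ (forall x, 0 <= f x <= 1) /\ (forall x, ~ U 0%nat x -> f x = 1) /\
    forall n x b, U n b -> f (x ⊕ b) <= f x + 2 / 2 ^ n.
Proof.
  (* The value 0 keeps [E x] nonempty for [x = e], which lies in every level. *)
  set (E := fun x r => r = 0 \/ exists n k, ~ level n k x /\ r = INR k / 2 ^ n).
  assert (pos : forall n, 0 < 2 ^ n) by (intro n; apply pow_lt; lra).
  assert (upper : forall n k x, level n k x -> is_upper_bound (E x) (INR k / 2 ^ n)).
  { intros n k x H r [->|[m [j [Hj ->]]]].
    - apply Rmult_le_pos; [apply pos_INR|]. apply Rlt_le, Rinv_0_lt_compat, pos.
    - assert (L : (j * 2 ^ n <= k * 2 ^ m)%nat).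
      { destruct (Nat.le_gt_cases (j * 2 ^ n) (k * 2 ^ m)) as [|L]; [assumption|].
        elim Hj. apply (level_compare n k); [exact H|lia]. }
      apply le_INR in L. rewrite !mult_INR, !pow_INR in L. simpl (INR 2) in L.
      replace (1 + 1) with 2 in L by lra.
      apply (Rmult_le_reg_r (2 ^ m * 2 ^ n)); [now apply Rmult_lt_0_compat|].
      assert (P1 := pos n). assert (P2 := pos m).
      replace (INR j / 2 ^ m * (2 ^ m * 2 ^ n)) with (INR j * 2 ^ n) by (field; lra).
      replace (INR k / 2 ^ n * (2 ^ m * 2 ^ n)) with (INR k * 2 ^ m) by (field; lra).
      exact L. }
  assert (lub : forall x, exists r, is_lub (E x) r).
  { intro x. destruct (completeness (E x)) as [r Hr].
    - exists (INR (2 ^ 0 * 2) / 2 ^ 0). apply upper, level_full.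
    - exists 0. now left.
    - now exists r. }
  destruct (choice _ lub) as [F HF].
  assert (F0 : forall x, 0 <= F x) by (intro x; apply HF; now left).
  assert (Fle : forall n k x, level n k x -> F x <= INR k / 2 ^ n).
  { intros n k x H. apply HF, upper, H. }
  assert (Fge : forall n k x, ~ level n k x -> INR k / 2 ^ n <= F x).
  { intros n k x H. apply HF. right. eauto. }
  (* With [k] least such that [x] lies in [level n k], [F x] is at least [(k - 1) / 2^n], while
     [x ⊕ b] lies in [level n (k + 1)]. *)
  assert (lip : forall n x b, U n b -> F (x ⊕ b) <= F x + 2 / 2 ^ n).
  { intros n x b Hb.
    destruct (wf_least lt (fun k => level n k x) Wf_nat.lt_wf
                (ex_intro (fun k => level n k x) _ (level_full n x))) as [k [Hk min]].
    assert (P := Rinv_0_lt_compat _ (pos n)).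
    assert (H := Fle _ _ _ (level_add n k x b Hk Hb)). destruct k as [|k].
    - specialize (F0 x). unfold Rdiv in *. simpl (INR 1) in H. lra.
    - assert (H' := Fge n k x (min k (Nat.lt_succ_diag_r k))).
      rewrite !S_INR in H. unfold Rdiv in *. lra. }
  exists (fun x => Rmin 1 (F x)). split; [|split; [|split]].
  - assert (H := Fle 0%nat 0%nat e eq_refl). simpl in H. specialize (F0 e).
    rewrite Rmin_right; lra.
  - intro x. split; [apply Rmin_glb; [lra|apply F0]|apply Rmin_l].
  - intros x Hx. assert (H := Fge 0%nat 1%nat x Hx). simpl in H. apply Rmin_left. lra.
  - intros n x b Hb. specialize (lip n x b Hb).
    assert (P : 0 < 2 / 2 ^ n) by (apply Rdiv_lt_0_compat; [lra|apply pos]).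
    unfold Rmin. destruct (Rle_dec 1 (F x)), (Rle_dec 1 (F (x ⊕ b))); lra.
Qed.

End Urysohn.

Open Scope R_scope.

(** The sets [U n] arise by repeatedly halving [W] translated to [e]. As they are symmetric, the
    one-sided bound of [urysohn_sequence] works in both directions and gives continuity. *)
Lemma group_completely_regular (W : G -> Prop) (x0 : G) :
  op W -> W x0 ->
  exists f : G -> R, continuous_real op f /\ (forall x, 0 <= f x <= 1) /\ f x0 = 0 /\
    forall x, ~ W x -> f x = 1.
Proof.
  intros oW Wx.
  assert (st : forall V, exists V', nbhd e V -> nbhd e V' /\ (forall x, V' x -> V' (inv x)) /\
                 forall x y, V' x -> V' y -> V (x ⊕ y)).
  { intro V. destruct (classic (nbhd e V)) as [H|H].
    - destruct (nbhd_half V H) as [V' H']. eauto.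
    - exists V. tauto. }
  destruct (choice _ st) as [half Hhalf]. clear st.
  set (W0 := fun z => W (z ⊕ x0)).
  assert (nb0 : nbhd e W0).
  { apply nbhd_translate. rewrite gid_l. exists W. auto. }
  set (U := fix U n := half (match n with O => W0 | S n => U n end)).
  assert (nbU : forall n, nbhd e (U n)).
  { induction n as [|n IH]; simpl; now apply Hhalf. }
  assert (symU : forall n x, U n x -> U n (inv x)).
  { intros [|n]; simpl; apply Hhalf; auto. }
  assert (addU : forall n x y, U (S n) x -> U (S n) y -> U n (x ⊕ y)).
  { intros n. simpl. apply Hhalf; auto. }
  destruct (urysohn_sequence U nbU addU) as [f [fe [f01 [f1 lip]]]].
  exists (fun x => f (x ⊕ inv x0)). split; [|split; [|split]].
  - intros x eps Heps.
    assert (L : exists n, 2 / 2 ^ n < eps).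
    { destruct (pow_lt_1_zero (/ 2)) with (y := eps / 2) as [n Hn];
        [rewrite Rabs_right; lra | lra |].
      exists n. specialize (Hn n (le_n n)). rewrite pow_inv in Hn.
      apply Rabs_def2 in Hn. unfold Rdiv in *. lra. }
    destruct L as [n Hn].
    destruct (nbhd_translate x (inv x) (U n)) as [V [oV [Vx HV]]].
    { rewrite ginv_r. apply nbU. }
    exists V. split; [exact oV|]. split; [exact Vx|]. intros y Vy. specialize (HV y Vy).
    assert (E1 : y ⊕ inv x0 = (x ⊕ inv x0) ⊕ (y ⊕ inv x)).
    { rewrite (gcomm y (inv x)), gadd_swap, ginv_r, gid_l. apply gcomm. }
    assert (E2 : x ⊕ inv x0 = (y ⊕ inv x0) ⊕ inv (y ⊕ inv x)).
    { rewrite E1 at 1. now rewrite <- gassoc, ginv_r, gid_r. }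
    assert (H1 := lip n (x ⊕ inv x0) _ HV). rewrite <- E1 in H1.
    assert (H2 := lip n (y ⊕ inv x0) _ (symU _ _ HV)). rewrite <- E2 in H2.
    apply Rabs_def1; lra.
  - intro x. apply f01.
  - now rewrite ginv_r.
  - intros x Hx. apply f1. intro H. apply Hx.
    assert (H' : W0 (x ⊕ inv x0 ⊕ e)).
    { refine (proj2 (proj2 (Hhalf W0 nb0)) _ _ H _). apply nbhd_at, (nbU 0%nat). }
    unfold W0 in H'. now rewrite gid_r, <- gassoc, ginv_l, gid_r in H'.
Qed.

End TopologicalGroup.

(** * The subsemigroup [Y] *)

(** Transfinite recursion with choice: the earlier values are extended by the constant [d], and
    locality of [spec] makes this extension harmless. *)
Lemma wf_choice {K B : Type} (lt : K -> K -> Prop) (spec : K -> (K -> B) -> B -> Prop) :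
  inhabited B -> well_founded lt ->
  (forall a y y' x, (forall b, lt b a -> y b = y' b) -> spec a y x -> spec a y' x) ->
  (forall a y, exists x, spec a y x) ->
  exists y, forall a, spec a y (y a).
Proof.
  intros [d] wf loc ex.
  destruct (choice (fun p x => spec (fst p) (snd p) x) (fun p => ex (fst p) (snd p))) as [h Hh].
  set (ext := fun a (rec : forall b, lt b a -> B) b =>
    match excluded_middle_informative (lt b a) with left p => rec b p | right _ => d end).
  set (y := Fix wf (fun _ => B) (fun a rec => h (a, ext a rec))).
  exists y. intro a.
  assert (E : y a = h (a, ext a (fun b _ => y b))).
  { unfold y at 1. rewrite Fix_eq; [reflexivity|].
    intros x f f' H. f_equal. f_equal. f_equal. extensionality b. extensionality p. apply H. }
  rewrite E. refine (loc _ _ _ _ _ (Hh (a, _))).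
  intros b Hb. simpl. unfold ext. destruct excluded_middle_informative; tauto.
Qed.

Section Wallace.

Context {G : Type} (op : (G -> Prop) -> Prop) (mul : G -> G -> G) (inv : G -> G) (e : G).
Hypothesis grp : abelian_group mul inv e.
Hypothesis tf : torsion_free mul e.

Local Notation "x ⊕ y" := (mul x y) (at level 50, left associativity).
Local Notation pow := (gpow mul e).

Lemma gpow_add x n m : pow x (n + m) = pow x n ⊕ pow x m.
Proof.
  induction n as [|n IH]; simpl.
  - symmetry. apply (gid_l mul inv e grp).
  - rewrite IH. apply (gassoc mul inv e grp).
Qed.

Lemma gpow_mul x y n : pow (x ⊕ y) n = pow x n ⊕ pow y n.
Proof.
  induction n as [|n IH]; simpl.
  - symmetry. apply (gid_l mul inv e grp).
  - rewrite IH. apply (gadd_swap mul inv e grp).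
Qed.

Lemma gpow_id n : pow e n = e.
Proof.
  induction n as [|n IH]; simpl; [reflexivity|]. rewrite IH. apply (gid_l mul inv e grp).
Qed.

Lemma gpow_base_inj x y n : 1 <= n -> pow x n = pow y n -> x = y.
Proof.
  intros Hn E. apply (gcancel mul inv e grp (inv y)).
  rewrite (ginv_l mul inv e grp). apply (tf _ n Hn).
  rewrite gpow_mul, E, <- gpow_mul, (ginv_l mul inv e grp). apply gpow_id.
Qed.

Lemma inv_mul x y : inv (x ⊕ y) = inv x ⊕ inv y.
Proof.
  apply (gcancel mul inv e grp (x ⊕ y)).
  now rewrite (gadd_swap mul inv e grp), !(ginv_r mul inv e grp), (gid_l mul inv e grp).
Qed.

Lemma quotient_eq a b c d : a ⊕ d = c ⊕ b -> a ⊕ inv b = c ⊕ inv d.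
Proof.
  intro E. apply (gcancel mul inv e grp (b ⊕ d)).
  rewrite (gcomm mul inv e grp a), (gadd_swap mul inv e grp b d), (ginv_r mul inv e grp).
  rewrite (gcomm mul inv e grp b d), (gcomm mul inv e grp c), (gadd_swap mul inv e grp d b).
  rewrite (ginv_r mul inv e grp), !(gid_l mul inv e grp).
  now rewrite (gcomm mul inv e grp d), (gcomm mul inv e grp b).
Qed.

Variable g : G.
Hypothesis gne : g <> e.

Lemma gpow_eq_id n : pow g n = e -> n = 0.
Proof.
  destruct n as [|n]; [auto|]. intro E. elim gne. apply (tf g (S n)); [lia|exact E].
Qed.

Lemma gpow_exp_inj n m : pow g n = pow g m -> n = m.
Proof.
  assert (H : forall n k, pow g (n + k) = pow g n -> k = 0).
  { intros i k E. apply gpow_eq_id. apply (gcancel mul inv e grp (pow g i)).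
    now rewrite <- gpow_add, (gid_r mul inv e grp). }
  intro E. destruct (Nat.le_ge_cases n m).
  - specialize (H n (m - n)). replace (n + (m - n)) with m in H by lia.
    specialize (H (eq_sym E)). lia.
  - specialize (H m (n - m)). replace (m + (n - m)) with n in H by lia.
    specialize (H E). lia.
Qed.

Lemma gpow_finite_to_one : finite_to_one (pow g).
Proof.
  intro v. destruct (classic (exists n, pow g n = v)) as [[n <-]|H].
  - exists (S n). intros m Hm E. apply gpow_exp_inj in E. lia.
  - exists 0. intros m _ E. eauto.
Qed.

(** Since [Z.to_nat] sends negative integers to 0, at least one of the two factors is [e]. *)
Definition zpow (z : Z) : G := pow g (Z.to_nat z) ⊕ inv (pow g (Z.to_nat (- z))).

Lemma zpow_sub i j : zpow (Z.of_nat i - Z.of_nat j) = pow g i ⊕ inv (pow g j).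
Proof.
  apply quotient_eq. rewrite <- !gpow_add. f_equal. lia.
Qed.

Lemma zpow_add a b : zpow (a + b) = zpow a ⊕ zpow b.
Proof.
  replace (a + b)%Z with (Z.of_nat (Z.to_nat a + Z.to_nat b)
    - Z.of_nat (Z.to_nat (- a) + Z.to_nat (- b)))%Z by lia.
  rewrite zpow_sub, !gpow_add, inv_mul. apply (gadd_swap mul inv e grp).
Qed.

Lemma zpow_0 : zpow 0 = e.
Proof. unfold zpow. simpl. apply (ginv_r mul inv e grp). Qed.

Lemma zpow_inj a b : zpow a = zpow b -> a = b.
Proof.
  intro E.
  assert (H : zpow (a - b) = e).
  { apply (gcancel mul inv e grp (zpow b)). rewrite <- zpow_add, (gid_r mul inv e grp).
    rewrite <- E. f_equal. lia. }
  replace (a - b)%Z with (Z.of_nat (Z.to_nat (a - b)) - Z.of_nat (Z.to_nat (b - a)))%Z in H by lia.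
  rewrite zpow_sub in H. apply (f_equal (fun t => t ⊕ pow g (Z.to_nat (b - a)))) in H.
  rewrite <- (gassoc mul inv e grp), (ginv_l mul inv e grp), (gid_r mul inv e grp),
    (gid_l mul inv e grp) in H.
  apply gpow_exp_inj in H. lia.
Qed.

(** * Formal expressions and independent points *)

(** The words that measure smallness double as formal expressions in the chosen points, so that a
    small set of indices allows few expressions. *)
Fixpoint val {K : Type} (y : K -> G) (l : word K) : G :=
  match l with
  | [] => e
  | inl b :: t => y b ⊕ val y t
  | inr 0 :: t => g ⊕ val y t
  | inr (S _) :: t => inv g ⊕ val y t
  end.

Lemma val_app {K : Type} (y : K -> G) (l l' : word K) : val y (l ++ l') = val y l ⊕ val y l'.
Proof.
  induction l as [|[b|[|n]] l IH]; simpl; rewrite ?IH, ?(gassoc mul inv e grp); auto.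
  symmetry. apply (gid_l mul inv e grp).
Qed.

Lemma val_ext {K : Type} (y y' : K -> G) (P : K -> Prop) (l : word K) :
  (forall b, P b -> y b = y' b) -> over P l -> val y l = val y' l.
Proof.
  intros E. induction l as [|[b|[|n]] l IH]; intro H; simpl; auto.
  2,3: f_equal; apply IH; intros a Ha; apply H; now right.
  f_equal; [apply E, H; now left|apply IH; intros a Ha; apply H; now right].
Qed.

Definition zword {K : Type} (z : Z) : word K :=
  repeat (inr 0) (Z.to_nat z) ++ repeat (inr 1) (Z.to_nat (- z)).

Lemma val_zword {K : Type} (y : K -> G) (z : Z) : val y (zword z) = zpow z.
Proof.
  unfold zword, zpow. rewrite val_app. f_equal.
  - induction (Z.to_nat z) as [|n IH]; simpl; [reflexivity|now rewrite IH].
  - induction (Z.to_nat (- z)) as [|n IH]; simpl; [|now rewrite IH, inv_mul].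
    rewrite <- (gid_l mul inv e grp (inv e)). symmetry. apply (ginv_r mul inv e grp).
Qed.

(** By torsion-freeness and injectivity of [c], an exponent [n >= 1] and a word [l] exclude at most
    one [k]. The function [f] reads it off the word [inr (n - 1) :: l], and smallness yields a [k]
    that [f] misses. *)
Lemma independent_choice (P : cantor -> Prop) (y c : cantor -> G) :
  small P -> (forall x x', c x = c x' -> x = x') ->
  exists k, forall n l, 1 <= n -> over P l -> pow (c k) n ⊕ val y l <> e.
Proof.
  intros HP inj.
  set (f := fun l : word cantor => match l with
    | inr n :: t => epsilon (inhabits (fun _ : nat => true)) (fun k => pow (c k) (S n) ⊕ val y t = e)
    | _ => fun _ => true end).
  destruct (HP f) as [k Hk]. exists k. intros [|n] l Hn Hl E; [lia|].
  apply (Hk (inr n :: l)).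
  - intros a [Ha|Ha]; [discriminate|auto].
  - simpl. set (k' := epsilon _ _).
    assert (E' : pow (c k') (S n) ⊕ val y l = e) by (apply epsilon_spec; eauto).
    apply inj, (gpow_base_inj _ _ (S n) Hn).
    apply (gcancel mul inv e grp (val y l)).
    now rewrite !(gcomm mul inv e grp (val y l)), E, E'.
Qed.

Lemma over_max {K : Type} (lt : K -> K -> Prop) (l : word K) :
  strict_total lt -> (exists a, In (inl a) l) ->
  exists a, In (inl a) l /\ over (fun x => lt x a \/ x = a) l.
Proof.
  intros [_ [tr tri]] [a Ha]. induction l as [|[c|n] l IH] in a, Ha |- *; [easy| |].
  - destruct (classic (exists b, In (inl b) l)) as [[b Hb]|N].
    + destruct (IH b Hb) as [m [Hm Om]]. destruct (tri m c) as [H|[<-|H]].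
      * exists c. split; [now left|]. intros x [E|Hx]; [right; congruence|].
        destruct (Om x Hx) as [H1| ->]; eauto.
      * exists m. split; [now left|]. intros x [E|Hx]; [right; congruence|auto].
      * exists m. split; [now right|]. intros x [E|Hx]; [left; congruence|auto].
    + exists c. split; [now left|]. intros x [E|Hx]; [right; congruence|]. elim N. eauto.
  - destruct Ha as [Ha|Ha]; [discriminate|]. destruct (IH a Ha) as [m [Hm Om]].
    exists m. split; [now right|]. intros x [E|Hx]; [discriminate|auto].
Qed.

(** Commutativity gathers the occurrences of [a] into one power, so that the independence of [y a]
    from the earlier points can be applied. *)
Lemma val_collect {K : Type} (lt : K -> K -> Prop) (y : K -> G) (a : K) (l : word K) :
  over (fun x => lt x a \/ x = a) l ->
  exists n l', over (fun x => lt x a) l' /\ val y l = pow (y a) n ⊕ val y l' /\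
    (In (inl a) l -> 1 <= n).
Proof.
  induction l as [|h l IH]; intro Hl.
  - exists 0, []. split; [intros x []|]. split; [|intros []].
    symmetry. apply (gid_l mul inv e grp).
  - destruct IH as [n [l' [Ol' [El In1]]]]; [intros x Hx; apply Hl; now right|].
    destruct (classic (h = inl a)) as [-> | ne].
    + exists (S n), l'. split; [exact Ol'|]. split; [|lia]. simpl. rewrite El.
      apply (gassoc mul inv e grp).
    + exists n, (h :: l'). split; [|split].
      * intros x [E|Hx]; [|auto]. destruct (Hl x) as [H| ->]; [now left|exact H|contradiction].
      * assert (H : forall l, val y (h :: l) = val y [h] ⊕ val y l)
          by (intro; apply (val_app y [h])).
        rewrite (H l), (H l'), El, !(gassoc mul inv e grp). f_equal. apply (gcomm mul inv e grp).
      * intros [E|Hx]; [contradiction|auto].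
Qed.

Hypothesis top : is_topology op.
Hypothesis haus : hausdorff op.
Hypothesis cmul : continuous_mul op mul.
Hypothesis cinv : continuous_inv op inv.
Hypothesis cc : countably_compact op.
Hypothesis nc : no_nontrivial_convergent_sequences op.

Lemma group_separation x y : x <> y ->
  exists f : G -> R, continuous_real op f /\ f x = 0%R /\ f y = 1%R.
Proof.
  intro ne. destruct (haus x y ne) as [U [V [oU [_ [Ux [Vy D]]]]]].
  destruct (group_completely_regular op mul inv e top grp cmul cinv U x oU Ux)
    as [f [Cf [_ [fx f1]]]].
  exists f. split; [exact Cf|]. split; [exact fx|]. apply f1. intro Uy. eauto.
Qed.

Lemma wallace_subsemigroup :
  exists Y : G -> Prop,
    (forall x y, Y x -> Y y -> Y (x ⊕ y)) /\
    (forall z x, Y x -> Y (zpow z ⊕ x)) /\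
    (forall z, ~ Y (zpow z)) /\
    forall s, finite_to_one s -> (forall n, Y (s n) \/ exists z, s n = zpow z) ->
      exists x, Y x /\ cluster op s (fun _ => True) x.
Proof.
  destruct (small_segments_order cantor small_empty) as [lt [st sm]].
  destruct (bookkeeping lt st sm) as [phi Hphi].
  assert (sm_lt : forall a, small (fun x => lt x a)).
  { intro a. apply (small_subset _ _ (sm a)). intros x H H'.
    destruct st as [wf [tr _]]. assert (K : lt x x) by eauto.
    clear - wf K. induction (wf x) as [x _ IH]. eauto. }
  destruct (wf_choice lt (fun a y x =>
    (forall n l, 1 <= n -> over (fun b => lt b a) l -> pow x n ⊕ val y l <> e) /\
    ((forall n, over (fun b => lt b a) (phi a n)) ->
      finite_to_one (fun n => val y (phi a n)) ->
      cluster op (fun n => val y (phi a n)) (fun _ => True) x))) as [y Hy].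
  - exact (inhabits e).
  - apply st.
  - intros a y y' x E [H1 H2]. split.
    + intros n l Hn Hl. rewrite <- (val_ext _ _ _ _ E Hl). auto.
    + intro O.
      assert (E' : (fun n => val y (phi a n)) = (fun n => val y' (phi a n))).
      { extensionality n. apply (val_ext _ _ _ _ E (O n)). }
      rewrite <- E'. auto.
  - intros a y.
    (* If the sequence given by [phi a] is not finite-to-one, the powers of [g] stand in for it, so
       that there is always an injective Cantor family of candidates. *)
    assert (C : exists s, finite_to_one s /\
              (finite_to_one (fun n => val y (phi a n)) -> s = fun n => val y (phi a n))).
    { destruct (classic (finite_to_one (fun n => val y (phi a n)))).
      - eauto.
      - exists (pow g). split; [apply gpow_finite_to_one|tauto]. }
    destruct C as [s [fs Hs]].
    destruct (cantor_of_clusters op top cc nc group_separation s fs) as [c [inj Hc]].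
    destruct (independent_choice _ y c (sm_lt a) inj) as [k Hk].
    exists (c k). split; [exact Hk|]. intros _ F. rewrite <- (Hs F). apply Hc.
  (* Isolating the largest letter [a] of [l] reduces this to the independence of [y a] from the
     earlier points. *)
  - assert (free : forall l, (exists a, In (inl a) l) -> val y l <> e).
    { intros l Hl. destruct (over_max lt l st Hl) as [a [Ha Oa]].
      destruct (val_collect lt y a l Oa) as [n [l' [Ol' [-> Hn]]]].
      apply Hy; auto. }
    exists (fun x => exists l, (exists a, In (inl a) l) /\ val y l = x).
    split; [|split; [|split]].
    + intros x x' [l [[a Ha] <-]] [l' [_ <-]]. exists (l ++ l').
      split; [|apply val_app]. exists a. apply in_or_app. auto.
    + intros z x [l [[a Ha] <-]]. exists (zword z ++ l). split.
      * exists a. apply in_or_app. auto.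
      * now rewrite val_app, val_zword.
    + intros z [l [[a Ha] E]]. apply (free (zword (- z) ++ l)).
      * exists a. apply in_or_app. auto.
      * rewrite val_app, val_zword, E, <- zpow_add, Z.add_opp_diag_l. apply zpow_0.
    + intros s fs Hs.
      assert (W : forall n, exists l, val y l = s n).
      { intro n. destruct (Hs n) as [[l [_ El]]|[z ->]]; [eauto|].
        exists (zword z). apply val_zword. }
      (* The index [b] lies above all letters of the words [w n], so [y b] was chosen as a cluster
         point of [s]. *)
      destruct (choice _ W) as [w Hw]. destruct (Hphi w) as [b [Eb Ob]].
      exists (y b). split.
      * exists [inl b]. split; [exists b; now left|]. apply (gid_r mul inv e grp).
      * assert (E : s = fun n => val y (phi b n)) by (extensionality n; now rewrite Eb).
        destruct (Hy b) as [_ H]. rewrite <- E, Eb in H. auto.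
Qed.

End Wallace.

(** * Extension of the bicyclic semigroup *)

Section Extension.

Context {G : Type} (op : (G -> Prop) -> Prop) (mul : G -> G -> G) (inv : G -> G) (e : G) (g : G)
  (Y : G -> Prop).
Hypothesis top : is_topology op.
Hypothesis grp : abelian_group mul inv e.
Hypothesis cmul : continuous_mul op mul.
Hypothesis cinv : continuous_inv op inv.
Hypothesis haus : hausdorff op.
Hypothesis tf : torsion_free mul e.
Hypothesis gne : g <> e.

Local Notation "x ⊕ y" := (mul x y) (at level 50, left associativity).
Local Notation zpow := (zpow mul inv e g).

Hypothesis Y_mul : forall x y, Y x -> Y y -> Y (x ⊕ y).
Hypothesis Y_zpow : forall z x, Y x -> Y (zpow z ⊕ x).
Hypothesis Y_free : forall z, ~ Y (zpow z).
Hypothesis Y_cluster : forall s, finite_to_one s -> (forall n, Y (s n) \/ exists z, s n = zpow z) ->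
  exists x, Y x /\ cluster op s (fun _ => True) x.

(* [Bi a b] stands for [p^a q^b], and [Int z] for the limit of the elements [p^a q^b] with
   [a - b = z]; the integers accumulate only at points of [Y]. *)
Inductive extension : Type :=
| Bi (a b : nat)
| Int (z : Z)
| Pt (x : G) (h : Y x).

Definition degree (a b : nat) : Z := (Z.of_nat a - Z.of_nat b)%Z.

Definition proj (s : extension) : G :=
  match s with Bi a b => zpow (degree a b) | Int z => zpow z | Pt x _ => x end.

Lemma Y_zpow_r z x : Y x -> Y (x ⊕ zpow z).
Proof. rewrite (gcomm mul inv e grp). apply Y_zpow. Qed.

(** In [p^a q^b p^c q^d] the relation [q p = 1] cancels [min b c] pairs, and the truncated
    differences are what remains. In the mixed products a bicyclic factor enters only through its
    degree. *)
Definition emul (s t : extension) : extension :=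
  match s, t with
  | Bi a b, Bi c d => Bi (a + (c - b)) (d + (b - c))
  | Bi a b, Int z => Int (degree a b + z)
  | Int z, Bi c d => Int (z + degree c d)
  | Int z, Int z' => Int (z + z')
  | Bi a b, Pt x h => Pt _ (Y_zpow (degree a b) x h)
  | Int z, Pt x h => Pt _ (Y_zpow z x h)
  | Pt x h, Bi a b => Pt _ (Y_zpow_r (degree a b) x h)
  | Pt x h, Int z => Pt _ (Y_zpow_r z x h)
  | Pt x h, Pt x' h' => Pt _ (Y_mul x x' h h')
  end.

Lemma Pt_eq x x' h h' : x = x' -> Pt x h = Pt x' h'.
Proof. intros <-. f_equal. apply proof_irrelevance. Qed.

Lemma proj_emul s t : proj (emul s t) = proj s ⊕ proj t.
Proof.
  destruct s, t; simpl; try reflexivity; rewrite <- (zpow_add mul inv e grp); f_equal.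
  unfold degree. lia.
Qed.

(** If a factor is a point of [Y], both sides are points of [Y] and are compared by their
    projections; the other cases are arithmetic of exponents. *)
Lemma emul_assoc : semigroup emul.
Proof.
  intros s t u.
  assert (P : proj (emul s (emul t u)) = proj (emul (emul s t) u)).
  { rewrite !proj_emul. apply (gassoc mul inv e grp). }
  destruct s, t, u; simpl in P |- *; first [apply Pt_eq; exact P | f_equal; unfold degree; lia].
Qed.

(** * Topology of the extension and continuity of the product *)

Definition eopen (O : extension -> Prop) : Prop :=
  forall s, O s ->
    match s with
    | Bi _ _ => True
    | Int z => exists N, forall a b, N <= a -> degree a b = z -> O (Bi a b)
    | Pt x _ => exists U, op U /\ U x /\ forall t, U (proj t) -> O t
    end.

Lemma eopen_topology : is_topology eopen.
Proof.
  split; [|split].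
  - intros [a b|z|x h] _; [exact I|exists 0; auto|].
    exists (fun _ => True). split; [apply top|auto].
  - intros U V oU oV s [Us Vs]. specialize (oU s Us). specialize (oV s Vs).
    destruct s as [a b|z|x h]; [exact I| |].
    + destruct oU as [N HN], oV as [M HM]. exists (N + M). intros a b Hab E.
      split; [apply HN|apply HM]; auto; lia.
    + destruct oU as [A [oA [Ax HA]]], oV as [B [oB [Bx HB]]].
      exists (fun y => A y /\ B y). split; [now apply top|]. split; [auto|].
      intros t [At Bt]. auto.
  - intros F HF s [U [FU Us]]. specialize (HF U FU s Us).
    destruct s as [a b|z|x h]; [exact I| |].
    + destruct HF as [N HN]. exists N. eauto.
    + destruct HF as [A [oA [Ax HA]]]. exists A. split; [exact oA|]. split; [exact Ax|]. eauto.
Qed.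

Lemma eopen_proj U : op U -> eopen (fun s => U (proj s)).
Proof.
  intros oU [a b|z|x h] Us; [exact I| |].
  - exists 0. intros a b _ E. simpl. rewrite E. exact Us.
  - exists U. auto.
Qed.

(** The sets [line z N] form a neighbourhood base of [Int z]. *)
Definition line (z : Z) (N : nat) (s : extension) : Prop :=
  match s with Bi a b => N <= a /\ degree a b = z | Int z' => z' = z | Pt _ _ => False end.

Lemma eopen_line z N : eopen (line z N).
Proof.
  intros [a b|z'|x h]; simpl; [auto| |contradiction].
  intros ->. exists N. auto.
Qed.

Lemma eopen_Bi a b : eopen (fun s => s = Bi a b).
Proof. intros s ->. exact I. Qed.

Lemma proj_line s z N : line z N s -> proj s = zpow z.
Proof. destruct s; simpl; [intros [_ <-]|intros <-|]; easy. Qed.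

Lemma emul_continuous_at_Pt s t x h : emul s t = Pt x h ->
  forall W, eopen W -> W (Pt x h) -> exists U V, eopen U /\ eopen V /\ U s /\ V t /\
    forall s' t', U s' -> V t' -> W (emul s' t').
Proof.
  intros E W oW Wx. destruct (oW _ Wx) as [A [oA [Ax HA]]].
  assert (Ast : A (proj s ⊕ proj t)) by (rewrite <- proj_emul, E; exact Ax).
  destruct (cmul _ _ A oA Ast) as [U [V [oU [oV [Us [Vt H]]]]]].
  exists (fun s => U (proj s)), (fun t => V (proj t)).
  split; [now apply eopen_proj|]. split; [now apply eopen_proj|].
  split; [exact Us|]. split; [exact Vt|]. intros s' t' Hs Ht. apply HA.
  rewrite proj_emul. auto.
Qed.

Lemma emul_continuous : continuous_mul eopen emul.
Proof.
  intros s t W oW Wst.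
  destruct (emul s t) as [a b|z|x h] eqn:E.
  (* Only two factors of the form [Bi] have a product of that form, and such factors are
     isolated. *)
  - exists (fun u => u = s), (fun u => u = t).
    destruct s, t; try discriminate.
    split; [apply eopen_Bi|]. split; [apply eopen_Bi|]. repeat split.
    intros u v -> ->. now rewrite E.
  - destruct (oW _ Wst) as [N HN].
    destruct s as [a b|z1|], t as [c d|z2|]; simpl in E; try discriminate; injection E as E.
    (* Left multiplication by [p^a q^b] lowers the first exponent by at most [b], hence the tail
       from [N + b]. *)
    + exists (fun u => u = Bi a b), (line z2 (N + b)).
      split; [apply eopen_Bi|]. split; [apply eopen_line|]. repeat split.
      intros u [c d|z'|x h] -> H; simpl in H; [|simpl; subst; exact Wst|easy].
      apply HN; unfold degree in *; lia.
    + exists (line z1 N), (fun u => u = Bi c d).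
      split; [apply eopen_line|]. split; [apply eopen_Bi|]. repeat split.
      intros [a b|z'|x h] u H ->; simpl in H; [|simpl; subst; exact Wst|easy].
      apply HN; unfold degree in *; lia.
    + exists (line z1 N), (line z2 N).
      split; [apply eopen_line|]. split; [apply eopen_line|]. repeat split.
      intros [a b|z'|x h] [c d|z''|x' h'] H H'; simpl in H, H'; try easy.
      * apply HN; unfold degree in *; lia.
      * simpl. replace (degree a b + z'')%Z with z by lia. exact Wst.
      * simpl. replace (z' + degree c d)%Z with z by lia. exact Wst.
      * simpl. replace (z' + z'')%Z with z by lia. exact Wst.
  - exact (emul_continuous_at_Pt s t x h E W oW Wst).
Qed.

Lemma proj_Pt s x h : proj s = x -> s = Pt x h.
Proof.
  destruct s as [a b|z|y k]; simpl; intro E.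
  - elim (Y_free (degree a b)). now rewrite E.
  - elim (Y_free z). now rewrite E.
  - now apply Pt_eq.
Qed.

(** * Separation axioms for the extension *)

Lemma extension_T1 : T1 eopen.
Proof.
  intros s t ne. destruct s as [a b|z|x h].
  - exists (fun s => s = Bi a b). split; [apply eopen_Bi|auto].
  - destruct t as [a b|z'|x h].
    + exists (line z (S a)). split; [apply eopen_line|]. simpl. split; [auto|lia].
    + exists (line z 0). split; [apply eopen_line|]. simpl. split; [auto|congruence].
    + exists (line z 0). split; [apply eopen_line|]. simpl. auto.
  - assert (ne' : x <> proj t).
    { intro E. apply ne. symmetry. now apply proj_Pt. }
    destruct (haus _ _ ne') as [U [V [oU [_ [Ux [Vt D]]]]]].
    exists (fun s => U (proj s)). split; [now apply eopen_proj|]. split; [exact Ux|]. eauto.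
Qed.

Lemma clopen_urysohn (C F : extension -> Prop) s :
  eopen C -> eopen (fun t => ~ C t) -> C s -> (forall t, F t -> ~ C t) ->
  exists f, continuous_real eopen f /\ (forall t, 0 <= f t <= 1)%R /\ f s = 0%R /\
    forall t, F t -> f t = 1%R.
Proof.
  intros oC oC' Cs HF.
  exists (fun t => if excluded_middle_informative (C t) then 0%R else 1%R).
  split; [|split; [|split]].
  - intros t eps Heps. destruct (classic (C t)) as [Ct|Ct].
    + exists C. split; [exact oC|]. split; [exact Ct|]. intros u Cu.
      do 2 destruct excluded_middle_informative; try tauto.
      rewrite Rminus_diag, Rabs_R0. exact Heps.
    + exists (fun t => ~ C t). split; [exact oC'|]. split; [exact Ct|]. intros u Cu.
      do 2 destruct excluded_middle_informative; try tauto.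
      rewrite Rminus_diag, Rabs_R0. exact Heps.
  - intro t. destruct excluded_middle_informative; lra.
  - destruct excluded_middle_informative; tauto.
  - intros t Ft. specialize (HF t Ft). destruct excluded_middle_informative; tauto.
Qed.

(* A line misses a neighbourhood of every point of [Y] because [Y] omits the powers of [g]. *)
Lemma eopen_line_compl z N : eopen (fun t => ~ line z N t).
Proof.
  intros [a b|z'|x h] H; [exact I| |].
  - exists 0. intros a b _ E. simpl in *. intros [_ E']. congruence.
  - assert (ne : x <> zpow z) by (intros ->; exact (Y_free _ h)).
    destruct (haus _ _ ne) as [U [V [oU [_ [Ux [Vz D]]]]]].
    exists U. split; [exact oU|]. split; [exact Ux|]. intros t Ut L.
    apply proj_line in L. rewrite L in Ut. eauto.
Qed.

Lemma eopen_Bi_compl a b : eopen (fun t => t <> Bi a b).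
Proof.
  intros [c d|z|x h] _; [exact I| |].
  - exists (S a). intros c d Hc _ E. injection E. lia.
  - destruct (eopen_line_compl (degree a b) 0 (Pt x h)) as [U [oU [Ux H]]]; [easy|].
    exists U. split; [exact oU|]. split; [exact Ux|]. intros t Ut ->.
    apply (H _ Ut). simpl. split; [lia|reflexivity].
Qed.

(** The points [Bi] and [Int] have clopen neighbourhood bases; at a point of [Y] a function on [G]
    is pulled back along [proj]. *)
Lemma extension_tychonoff : tychonoff eopen.
Proof.
  split; [exact extension_T1|]. intros F s cF Fs. destruct s as [a b|z|x h].
  - apply (clopen_urysohn (fun s => s = Bi a b)).
    + apply eopen_Bi.
    + apply eopen_Bi_compl.
    + reflexivity.
    + intros t Ft ->. contradiction.
  - destruct (cF _ Fs) as [N HN]. apply (clopen_urysohn (line z N)).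
    + apply eopen_line.
    + apply eopen_line_compl.
    + reflexivity.
    + intros [a b|z'|y k] Ft; simpl; [|congruence|auto].
      intros [H E]. exact (HN a b H E Ft).
  - destruct (cF _ Fs) as [U [oU [Ux HU]]].
    destruct (group_completely_regular op mul inv e top grp cmul cinv U x oU Ux)
      as [f [Cf [f01 [fx f1]]]].
    exists (fun s => f (proj s)). split; [|split; [|split]].
    + intros t eps Heps. destruct (Cf (proj t) eps Heps) as [V [oV [Vt HV]]].
      exists (fun s => V (proj s)). split; [now apply eopen_proj|]. auto.
    + intro t. apply f01.
    + exact fx.
    + intros t Ft. apply f1. intro Ut. exact (HU t Ut Ft).
Qed.

(** * Countable compactness of the extension *)

(** If no value recurs infinitely often, the sequence finally avoids the finitely many [Bi a b] on
    the line with [a < M], so its terms on the line enter every neighbourhood of [Int z]. *)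
Lemma line_cluster (s : nat -> extension) (z : Z) :
  infinite_set (fun n => proj (s n) = zpow z) ->
  exists x, cluster eopen s (fun _ => True) x.
Proof.
  intro Hz. destruct (classic (exists t, infinite_set (fun n => s n = t))) as [[t Ht]|N].
  - exists t. intros O _ Ot n. destruct (Ht n) as [m [Hm <-]]. eauto.
  - exists (Int z). intros O oO Oz n. destruct (oO _ Oz) as [M HM].
    assert (F : exists k, forall m, k <= m -> forall a b, a < M -> degree a b = z -> s m <> Bi a b).
    { clear HM. induction M as [|M [k Hk]]; [exists 0; lia|].
      (* This is the only possible element [Bi M b] of degree [z]. *)
      assert (H : ~ infinite_set (fun n => s n = Bi M (Z.to_nat (Z.of_nat M - z)))) by eauto.
      apply not_all_ex_not in H. destruct H as [k' Hk']. exists (k + k').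
      intros m Hm a b Ha E. destruct (Nat.eq_dec a M) as [->|ne]; [|apply Hk; lia].
      intro E'. apply Hk'. exists m. split; [lia|]. rewrite E'. f_equal.
      unfold degree in E. lia. }
    destruct F as [k Hk]. destruct (Hz (n + k)) as [m [Hm E]]. exists m. split; [lia|].
    split; [exact I|]. destruct (s m) as [a b|z'|x h] eqn:Es; simpl in E.
    + apply (zpow_inj mul inv e grp tf g gne) in E. apply HM; [|exact E].
      destruct (Nat.le_gt_cases M a) as [|L]; [assumption|].
      elim (Hk m) with (a := a) (b := b); auto. lia.
    + apply (zpow_inj mul inv e grp tf g gne) in E. now rewrite E.
    + elim (Y_free z). now rewrite <- E.
Qed.

(** Either the projected sequence is finite-to-one and clusters in [Y], or it takes one value
    infinitely often, whose fibre is a line with its limit or a single point of [Y]. *)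
Lemma extension_cluster (s : nat -> extension) : exists x, cluster eopen s (fun _ => True) x.
Proof.
  destruct (classic (finite_to_one (fun n => proj (s n)))) as [fs|nfs].
  - destruct (Y_cluster _ fs) as [x [h Cx]].
    + intro n. destruct (s n) as [a b|z|x h]; simpl; eauto.
    + exists (Pt x h). intros O oO Ox. destruct (oO _ Ox) as [U [oU [Ux HU]]].
      intro N. destruct (Cx U oU Ux N) as [n [Hn [_ Un]]]. eauto.
  - apply not_all_ex_not in nfs. destruct nfs as [v Hv].
    assert (I : infinite_set (fun n => proj (s n) = v)).
    { intro N. apply NNPP. intro H. apply Hv. exists N. intros n Hn E. eauto. }
    destruct (I 0) as [n [_ En]]. destruct (s n) as [a b|z|x h]; simpl in En; subst v.
    + exact (line_cluster s _ I).
    + exact (line_cluster s _ I).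
    + exists (Pt x h). intros O _ Ox N. destruct (I N) as [m [Hm Em]].
      exists m. rewrite (proj_Pt _ x h Em). auto.
Qed.

Lemma extension_countably_compact : countably_compact eopen.
Proof.
  intros U oU cov. apply NNPP. intro H.
  assert (K : forall N, exists x, forall n, n <= N -> ~ U n x).
  { intro N. apply NNPP. intro K. apply H. exists N. intro x. apply NNPP. intro K'.
    apply K. exists x. intros n Hn Ux. eauto. }
  destruct (choice _ K) as [s Hs]. destruct (extension_cluster s) as [x Cx].
  destruct (cov x) as [m Um]. destruct (Cx (U m) (oU m) Um m) as [n [Hn [_ Un]]].
  exact (Hs n m Hn Un).
Qed.

(** * Embedding of the bicyclic semigroup *)

Definition generator (l : pq_letter) : extension :=
  match l with Lp => Bi 1 0 | Lq => Bi 0 1 end.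

Fixpoint evaluate (w : list pq_letter) : extension :=
  match w with [] => Bi 0 0 | l :: w => emul (generator l) (evaluate w) end.

Lemma bicyclic_cong_app x u v : bicyclic_cong u v -> bicyclic_cong (x ++ u) (x ++ v).
Proof.
  induction 1.
  - rewrite !(app_assoc x u). apply bc_step.
  - apply bc_refl.
  - now apply bc_sym.
  - eapply bc_trans; eassumption.
Qed.

(** Every word is congruent to a normal form whose exponents are read off its value; hence words
    with equal values are congruent. *)
Lemma evaluate_normal_form w : exists a b,
  evaluate w = Bi a b /\ bicyclic_cong w (repeat Lp a ++ repeat Lq b).
Proof.
  induction w as [|l w [a [b [E C]]]].
  - exists 0, 0. split; [reflexivity|apply bc_refl].
  - apply (bicyclic_cong_app [l]) in C. simpl. rewrite E. destruct l.
    + exists (S a), b. split; [|exact C]. simpl. f_equal; lia.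
    + destruct a as [|a].
      * exists 0, (S b). split; [|exact C]. simpl. f_equal; lia.
      * exists a, b. split; [simpl; f_equal; lia|].
        eapply bc_trans; [exact C|]. apply (bc_step []).
Qed.

Lemma evaluate_app w v : evaluate (w ++ v) = emul (evaluate w) (evaluate v).
Proof.
  induction w as [|l w IH]; simpl.
  - destruct (evaluate_normal_form v) as [a [b [-> _]]]. simpl. f_equal; lia.
  - rewrite IH. apply emul_assoc.
Qed.

Lemma extension_contains_bicyclic : contains_bicyclic emul.
Proof.
  exists evaluate. split; [exact evaluate_app|]. intros w v. split.
  - intro E. destruct (evaluate_normal_form w) as [a [b [Ew Cw]]].
    destruct (evaluate_normal_form v) as [c [d [Ev Cv]]].
    rewrite Ew, Ev in E. injection E as -> ->.
    eapply bc_trans; [exact Cw|]. now apply bc_sym.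
  - induction 1; try congruence. rewrite !evaluate_app. f_equal. simpl.
    destruct (evaluate_normal_form v) as [a [b [-> _]]]. simpl. f_equal; lia.
Qed.

End Extension.

Open Scope R_scope.

Theorem theorem6p6 :
  (exists (G : Type) (opG : (G -> Prop) -> Prop) (mul : G -> G -> G) (inv : G -> G) (e : G),
      is_topology opG /\ abelian_group mul inv e /\
      continuous_mul opG mul /\ continuous_inv opG inv /\
      hausdorff opG /\ countably_compact opG /\
      torsion_free mul e /\ (exists x : G, x <> e) /\
      no_nontrivial_convergent_sequences opG) ->
  exists (S : Type) (opS : (S -> Prop) -> Prop) (mulS : S -> S -> S),
      is_topology opS /\ semigroup mulS /\ continuous_mul opS mulS /\
      tychonoff opS /\ countably_compact opS /\ contains_bicyclic mulS.
Proof.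
  intros (G & op & mul & inv & e & top & grp & cmul & cinv & haus & cc & tf & [g gne] & nc).
  destruct (wallace_subsemigroup op mul inv e grp tf g gne top haus cmul cinv cc nc)
    as (Y & Y_mul & Y_zpow & Y_free & Y_cluster).
  exists (extension Y), (eopen op mul inv e g Y), (emul mul inv e g Y grp Y_mul Y_zpow).
  split; [|split; [|split; [|split; [|split]]]].
  - now apply eopen_topology.
  - now apply emul_assoc.
  - now apply emul_continuous.
  - now apply extension_tychonoff.
  - now apply extension_countably_compact.
  - now apply extension_contains_bicyclic.
Qed.
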